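(* Let $\lambda\leq 1$ and let $G$ be a $\lambda$-expander on $n$ vertices with minimum degree $d$ and maximum degree $(1+o(1))d$. Let $p\in[0,1]$ be such that $p^2\lambda d=\omega(\log n)$, and let $V_p$ be a $p$-random subset of $V(G)$. Then $G[V_p]$ is an $\Omega(p\lambda)$-expander with probability at least $1-2^{-\Omega(p^2\lambda d)}$.
   Context: All graphs are finite and simple. A graph $H$ is a $\mu$-expander if for every $U\subseteq V(H)$ with $|U|\leq |V(H)|/2$ we have $|N_H(U)|\geq \mu|U|$, where $N_H(U)$ is the external neighborhood of $U$ (the vertices outside $U$ having a neighbor in $U$). A $p$-random subset $V_p$ of $V(G)$ contains every vertex independently with probability $p$. Asymptotic notation is with respect to $n\to\infty$: $p^2\lambda d=\omega(\log n)$ means $p^2\lambda d/\log n\to\infty$; $o(1)$ denotes a quantity tending to $0$; the constants hidden in $\Omega(\cdot)$ are absolute positive constants; the statement is for all sufficiently large $n$ (where how large may depend only on the rates in the $\omega(\cdot)$ and $o(1)$ hypotheses). *)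

(* Defs.v *)
From mathcomp Require Import all_boot all_order all_algebra.
From mathcomp Require Import all_classical all_reals all_analysis.

Set Implicit Arguments.
Unset Strict Implicit.
Unset Printing Implicit Defensive.

Import Order.TTheory GRing.Theory Num.Theory.
Import numFieldNormedType.Exports.

Local Open Scope ring_scope.

(* A finite simple graph is a symmetric irreflexive [e : rel T] over a
   [T : finType]; the two properties are hypotheses where they are needed. *)

Definition degree (T : finType) (e : rel T) (x : T) : nat :=
  #|[set y | e x y]|.

(* Degrees in a simple graph are smaller than #|T|, so the default value #|T|
   of the minimum plays no role as soon as T is nonempty. *)
Definition min_degree (T : finType) (e : rel T) : nat :=
  \big[minn/#|T|]_(x : T) degree e x.

Definition max_degree (T : finType) (e : rel T) : nat :=
  (\max_(x : T) degree e x)%N.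

Definition ext_neighborhood (T : finType) (e : rel T) (U : {set T}) : {set T} :=
  [set y | (y \notin U) && [exists x in U, e x y]].

Definition is_expander (R : realType) (mu : R) (T : finType) (e : rel T) : bool :=
  [forall U : {set T}, (#|U|%:R <= #|T|%:R / 2 :> R) ==>
     (mu * #|U|%:R <= #|ext_neighborhood e U|%:R)].

Definition induced_subgraph (T : finType) (e : rel T) (S : {set T}) :
    rel {x : T | x \in S} :=
  fun u v => e (val u) (val v).
Arguments induced_subgraph {T} e S u v.

(* Probability of the event E for the p-random subset of T: the law is the
   product over T of Bernoulli(p) laws. *)
Definition prob_random_subset (R : realType) (T : finType) (p : R)
    (E : pred {set T}) : R :=
  \sum_(S : {set T} | E S) \prod_(x : T) (if x \in S then p else 1 - p).

(* Main.v *)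
Require Import Defs.
From mathcomp Require Import all_boot all_order all_algebra.
From mathcomp Require Import all_classical all_reals all_analysis.
From mathcomp Require Import ring lra fintype finset.

(** Write [S] for the random set [V_p], let [n] be the number of vertices, and
    suppose that some nonempty [U] inside [S], with [#|U| <= #|S| / 2], has a
    neighborhood [W] inside [S] of size below [q / 100], where
    [q = p * lambda * #|U|].  A union bound over [U] is far too expensive: each
    [U] would be excluded only up to probability about [exp (- q)], which cannot pay
    for the choice of [#|U|] vertices.  Instead [U] is replaced by a fingerprint
    [X], a subset of about [#|U| / (p * d)] vertices of [U], which costs
    [#|U| * ln n / (p * d)] in the union bound.  The hypothesis that
    [p ^ 2 * lambda * d] is much larger than [ln n] says precisely that this
    cost is much smaller than [q].

    The fingerprint is a subset [X] of [U] maximal with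
    [#|N(X)| >= #|X| * d / 10] (lemma [fingerprint]); by maximality every vertex
    of [U] sends at least [9/10 * d] edges into [Y = N(X)].  So [U] lies in the
    set [A] ([core]) of all vertices with this property, and both [Y] and [A]
    depend on [X] only.  The vertices of [Y] that survive in [S] are in
    [U] or [W], hence [#|Y|] is at most slightly above [#|U| / p]; near-regularity
    then gives that [#|A|] is of order [#|U| / p] and bounded away from [n]
    (only here do the constants in the bounds on [#|Y|] matter).  Expansion of [G] yields a
    matching of at least [lambda * min (#|A|, n - #|A|) / 4] edges between [A] and
    its complement ([crossing_matching_exists]).  About [p ^ 2] of these edges
    survive, that is a constant times [q] of them.  A surviving edge starting in
    [U] ends in [W], so all but few of the surviving edges start in
    [Z = (A :&: S) :\: (U :|: W)].

    Vertices of [Z] send most of their edges into [Y] but have no neighbor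
    in [U], so the survivors among their neighbors in [Y] are all in the small set
    [W].  A second fingerprint, [B] inside [Z], turns this into an unlikely event
    that depends on [X] and [B] only: the set [N(B) :&: Y] is either small or
    has far too few survivors.  If it is small, then counting edges between it
    and [Z] in two ways bounds [#|Z|] by a small multiple of [q], a
    contradiction.  This deterministic part is [expanding_sets_survive].

    What randomness must provide is thus: upper bounds on the degrees into
    [S] and on [#|S|], and a Chernoff lower bound holding for all pairs [(X, B)]
    at once ([prob_blocks_uniform]), for four families of disjoint blocks that are
    functions of [(X, B)]. *)

Set Implicit Arguments.
Unset Strict Implicit.
Unset Printing Implicit Defensive.

Import Order.TTheory GRing.Theory Num.Theory.
Import numFieldNormedType.Exports.

Local Open Scope ring_scope.

(** * The product measure on subsets *)

Definition weight (R : realType) (T : finType) (p : R) (S : {set T}) : R :=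
  \prod_(x : T) (if x \in S then p else 1 - p).

Definition expect (R : realType) (T : finType) (p : R) (f : {set T} -> R) : R :=
  \sum_(S : {set T}) weight p S * f S.

Section Probability.
Variables (R : realType) (T : finType) (p : R).
Hypothesis p01 : 0 <= p <= 1.
Implicit Types (S D B : {set T}) (f g : {set T} -> R) (P : {set {set T}}).

Lemma weight_ge0 S : 0 <= weight p S.
Proof.
have /andP[? ?] := p01.
by apply: prodr_ge0 => x _; case: ifP => _ //; rewrite subr_ge0.
Qed.

(** Independence of the vertices, in the form of the distributivity of product
    over sum. *)
Lemma expect_prod (h : T -> bool -> R) :
  expect p (fun S => \prod_x h x (x \in S)) =
  \prod_x (p * h x true + (1 - p) * h x false).
Proof.
rewrite bigA_distr; apply: eq_bigr => S _.
by rewrite /weight -big_split; apply: eq_bigr => x _; case: (x \in S).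
Qed.

Lemma expect_cst c : expect p (fun _ : {set T} => c) = c.
Proof.
rewrite /expect -mulr_suml -[RHS]mul1r; congr (_ * _).
have := expect_prod (fun _ _ => 1); rewrite [RHS]big1 => [<-|x _]; last by ring.
by apply: eq_bigr => S _; rewrite big1 // mulr1.
Qed.

Lemma expect_le f g : (forall S, f S <= g S) -> expect p f <= expect p g.
Proof. by move=> fg; apply: ler_sum => S _; rewrite ler_wpM2l ?weight_ge0. Qed.

Lemma expectZ c f : expect p (fun S => c * f S) = c * expect p f.
Proof. by rewrite /expect mulr_sumr; apply: eq_bigr => S _; ring. Qed.

Lemma prob_expect (E : pred {set T}) :
  prob_random_subset p E = expect p (fun S => (E S)%:R).
Proof.
rewrite /prob_random_subset /expect big_mkcond; apply: eq_bigr => S _.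
by rewrite /weight; case: (E S); rewrite ?mulr1 ?mulr0.
Qed.

Lemma prob_le_expect (E : pred {set T}) g :
  (forall S, 0 <= g S) -> (forall S, E S -> 1 <= g S) ->
  prob_random_subset p E <= expect p g.
Proof.
move=> g0 g1; rewrite prob_expect; apply: expect_le => S.
by case: (boolP (E S)) => [/g1|_]; rewrite ?g0.
Qed.

Lemma prob_mono (E F : pred {set T}) : (forall S, E S -> F S) ->
  prob_random_subset p E <= prob_random_subset p F.
Proof.
move=> EF; rewrite !prob_expect; apply: expect_le => S.
by rewrite ler_nat; case: (boolP (E S)) => [/EF ->|].
Qed.

Lemma prob_compl (E : pred {set T}) :
  prob_random_subset p E = 1 - prob_random_subset p (fun S => ~~ E S).
Proof.
apply/eqP; rewrite eq_sym subr_eq -[X in X == _]expect_cst !prob_expect; apply/eqP.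
rewrite /expect -big_split; apply: eq_bigr => S _ /=.
by case: (E S); rewrite ?mulr1 ?mulr0 ?addr0 ?add0r.
Qed.

Lemma prob_union (E F : pred {set T}) :
  prob_random_subset p (fun S => E S || F S) <=
  prob_random_subset p E + prob_random_subset p F.
Proof.
rewrite !prob_expect /expect -big_split; apply: ler_sum => S _ /=.
rewrite -mulrDr; apply: ler_wpM2l; first exact: weight_ge0.
by rewrite -natrD ler_nat; case: (E S) => //=; case: (F S).
Qed.

Lemma prob_exists (I : finType) (E : I -> pred {set T}) :
  prob_random_subset p (fun S => [exists i, E i S]) <=
  \sum_i prob_random_subset p (E i).
Proof.
rewrite prob_expect /expect.
rewrite (eq_bigr _ (fun i _ => prob_expect (E i))) /expect.
rewrite exchange_big; apply: ler_sum => S _ /=.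
rewrite -mulr_sumr; apply: ler_wpM2l; first exact: weight_ge0.
case: existsP => [[i Ei]|_]; last by rewrite sumr_ge0.
by rewrite (bigD1 i) //= Ei lerDl sumr_ge0.
Qed.

(** Exchanging the traces of two independent copies on [D] preserves their joint
    law, and turns [f S * g S'] into [f S * g S]. *)
Lemma expect_indep D f g :
  (forall S, f S = f (S :&: D)) -> (forall S, g S = g (S :\: D)) ->
  expect p (fun S => f S * g S) = expect p f * expect p g.
Proof.
move=> fD gD.
pose sw (A : {set T} * {set T}) :=
  ((A.1 :&: D) :|: (A.2 :\: D), (A.2 :&: D) :|: (A.1 :\: D)).
have swK : involutive sw.
  by case=> A B; congr (_, _); apply/setP => x; rewrite !inE /=;
    case: (x \in A); case: (x \in B); case: (x \in D).
rewrite [RHS]big_distrlr /= pair_bigA /= (reindex_inj (inv_inj swK)) /=.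
transitivity (\sum_(A : {set T} * {set T})
    (weight p A.1 * (f A.1 * g A.1)) * (weight p A.2 * 1)).
  rewrite -(pair_bigA _ (fun A B => (weight p A * (f A * g A)) * (weight p B * 1))).
  rewrite -big_distrlr /= -/(expect p (fun S => f S * g S)).
  by rewrite -/(expect p (fun _ : {set T} => 1)) expect_cst mulr1.
apply: eq_bigr => -[A B] _ /=.
have -> : f (A :&: D :|: B :\: D) = f A.
  rewrite fD [in RHS]fD; congr f; apply/setP => x; rewrite !inE.
  by case: (x \in A); case: (x \in B); case: (x \in D).
have -> : g (B :&: D :|: A :\: D) = g A.
  rewrite gD [in RHS]gD; congr g; apply/setP => x; rewrite !inE.
  by case: (x \in A); case: (x \in B); case: (x \in D).
have ww : weight p A * weight p B = weight p (A :&: D :|: B :\: D) *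
    weight p (B :&: D :|: A :\: D).
  rewrite /weight -!big_split; apply: eq_bigr => x _ /=; rewrite !inE.
  by case: (x \in A); case: (x \in B); case: (x \in D); rewrite //= mulrC.
rewrite mulr1 mulrACA -ww; ring.
Qed.

Lemma expect_subset B : expect p (fun S => (B \subset S)%:R) = p ^+ #|B|.
Proof.
have EB := expect_prod (fun x b => ((x \in B) ==> b)%:R).
transitivity (\prod_(x : T) (p * ((x \in B) ==> true)%:R +
    (1 - p) * ((x \in B) ==> false)%:R)).
  rewrite -EB; apply: eq_bigr => S _; congr (_ * _).
  case: (boolP (B \subset S)) => [/subsetP sBS|/subsetPn[x xB xS]].
    by rewrite big1 // => x _; case: (boolP (x \in B)) => // /sBS ->.
  by rewrite (bigD1 x) //= xB (negbTE xS) mul0r.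
rewrite -prodr_const [RHS]big_mkcond; apply: eq_bigr => x _.
by case: (x \in B) => /=; ring.
Qed.

End Probability.

(** * Chernoff bounds for disjoint blocks *)

(** For pairwise disjoint blocks of [r] vertices this count is a binomial variable
    with success probability [p ^+ r].  Singletons ([r = 1]) give the size of a
    random subset of a fixed set, edges of a matching ([r = 2]) the number of
    matching edges that survive. *)
Definition blocks_in (T : finType) (P : {set {set T}}) (S : {set T}) : nat :=
  #|[set B in P | B \subset S]|.

Section Chernoff.
Variables (R : realType) (T : finType) (p : R).
Hypothesis p01 : 0 <= p <= 1.
Implicit Types (S D B : {set T}) (P : {set {set T}}).

(** Disjoint blocks are independent, so the generating function is that of a
    binomial law. *)
Lemma expect_pow_blocks r t P : trivIset P -> (forall B, B \in P -> #|B| = r) ->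
  expect p (fun S => t ^+ blocks_in P S) = (1 + (t - 1) * p ^+ r) ^+ #|P|.
Proof.
have [k] := ubnP #|P|; elim: k P => // k IH P ltk trP cP.
have [->|[B BP]] := set_0Vmem P.
  rewrite cards0 expr0 -[RHS](expect_cst T p 1); apply: eq_bigr => S _.
  rewrite (_ : blocks_in _ _ = 0%N) ?expr0 //.
  by apply/eqP; rewrite cards_eq0; apply/eqP/setP => C; rewrite !inE.
have cPB : #|P| = (#|P :\ B|).+1 by rewrite (cardsD1 B P) BP.
have trPB : trivIset (P :\ B) := trivIsetS (subsetDl _ _) trP.
rewrite cPB exprS -IH //; last 2 first.
- by rewrite -ltnS -cPB.
- by move=> C; rewrite !inE => /andP[_ /cP].
have -> : 1 + (t - 1) * p ^+ r = expect p (fun S : {set T} => t ^+ (B \subset S)).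
  transitivity (expect p (fun _ : {set T} => 1) +
      expect p (fun S => (t - 1) * (B \subset S)%:R)).
    by rewrite expectZ (expect_cst T p) expect_subset (cP _ BP).
  rewrite /expect -big_split; apply: eq_bigr => S _ /=.
  by case: (B \subset S) => /=; rewrite ?expr1 ?expr0; ring.
rewrite -(@expect_indep _ _ _ B).
- apply: eq_bigr => S _; congr (_ * _); rewrite -exprD; congr (_ ^+ _).
  rewrite /blocks_in (cardsD1 B) !inE BP; congr (_ + _)%N.
  by apply: eq_card => C; rewrite !inE andbA.
- by move=> S; rewrite subsetI subxx andbT.
- move=> S; congr (_ ^+ _); apply: eq_card => C; rewrite !inE.
  case: (boolP (C == B)) => //= nCB; case: (boolP (C \in P)) => //= CP.
  rewrite subsetD; move/trivIsetP: trP => /(_ _ _ CP BP nCB) ->.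
  by rewrite andbT.
Qed.

Lemma expr1D_le_expR (x : R) m : 0 <= 1 + x -> (1 + x) ^+ m <= expR (x * m%:R).
Proof.
by move=> x0; rewrite expRM_natr lerXn2r ?nnegrE ?expR_ge0 // expR_ge1Dx.
Qed.

(** Markov's inequality for the exponential moment with parameter [s]. *)
Lemma prob_blocks_exp r s b (E : pred {set T}) P :
  trivIset P -> (forall B, B \in P -> #|B| = r) ->
  (forall S, E S -> b <= s * (blocks_in P S)%:R) ->
  prob_random_subset p E <=
  expR ((expR s - 1) * (p ^+ r * #|P|%:R) - b).
Proof.
move=> trP cP Eb; have /andP[p0 p1] := p01.
apply: (@le_trans _ _ (expect p (fun S => expR (- b) * expR s ^+ blocks_in P S))).
  apply: prob_le_expect => // S /Eb ES; rewrite -expRM_natr -expRD.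
  by apply: le_trans (expR_ge1Dx _); lra.
rewrite expectZ (expect_pow_blocks _ trP cP) [_ - b]addrC expRD.
rewrite ler_wpM2l ?expR_ge0 // mulrA expr1D_le_expR //.
have pr1 : p ^+ r <= 1 by rewrite exprn_ile1.
have pr0 : 0 <= p ^+ r by rewrite exprn_ge0.
have := expR_gt0 s; nra.
Qed.

(** For a relative deviation [delta = 1/10] the parameter is [s = - delta / 2]:
    the bound [expR s <= (1 - s)^-1] then gives an exponent of at most
    [- delta ^ 2 / 4] times the mean.  The upper tail uses [s = delta / 4]. *)
Lemma prob_blocks_lower r P :
  trivIset P -> (forall B, B \in P -> #|B| = r) ->
  prob_random_subset p
    (fun S => (blocks_in P S)%:R < 9/10 * (p ^+ r * #|P|%:R)) <=
  expR (- (p ^+ r * #|P|%:R / 400)).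
Proof.
move=> trP cP; set mu := p ^+ r * _; have /andP[p0 p1] := p01.
have mu0 : 0 <= mu by rewrite mulr_ge0 ?exprn_ge0.
apply: le_trans (@prob_blocks_exp r (- 20^-1) (- 20^-1 * (9/10 * mu)) _ P trP cP _) _.
  by move=> S /ltW; lra.
have e1 : expR (- 20^-1) <= 20 / 21 :> R.
  rewrite expRN invf_ple ?posrE ?expR_gt0 //.
  by rewrite (le_trans _ (expR_ge1Dx _)) //; lra.
rewrite ler_expR -/mu; nra.
Qed.

Lemma prob_blocks_upper r P :
  trivIset P -> (forall B, B \in P -> #|B| = r) ->
  prob_random_subset p
    (fun S => 11/10 * (p ^+ r * #|P|%:R) < (blocks_in P S)%:R) <=
  expR (- (p ^+ r * #|P|%:R / 800)).
Proof.
move=> trP cP; set mu := p ^+ r * _; have /andP[p0 p1] := p01.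
have mu0 : 0 <= mu by rewrite mulr_ge0 ?exprn_ge0.
apply: le_trans (@prob_blocks_exp r (40^-1) (40^-1 * (11/10 * mu)) _ P trP cP _) _.
  by move=> S /ltW; lra.
have e1 : expR (40^-1) <= 40 / 39 :> R.
  rewrite -[40^-1]opprK expRN invf_ple ?posrE ?expR_gt0 //.
  by rewrite (le_trans _ (expR_ge1Dx _)) //; lra.
rewrite ler_expR -/mu; nra.
Qed.

Definition singleton_blocks (D : {set T}) : {set {set T}} := [set [set x] | x in D].

Lemma trivIset_singleton_blocks D : trivIset (singleton_blocks D).
Proof.
apply/trivIsetP => _ _ /imsetP[x _ ->] /imsetP[y _ ->] nxy.
by rewrite disjoints1 inE; apply: contraNN nxy => /eqP ->.
Qed.

Lemma card_singleton_blocks D : #|singleton_blocks D| = #|D|.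
Proof. exact/card_imset/set1_inj. Qed.

Lemma blocks_in_singleton_blocks D S : blocks_in (singleton_blocks D) S = #|D :&: S|.
Proof.
rewrite -(card_imset (D :&: S) set1_inj); apply: eq_card => B; rewrite inE.
apply/andP/imsetP => [[/imsetP[x xD ->]]|[x]].
  by rewrite sub1set => xS; exists x; rewrite // inE xD.
by rewrite inE => /andP[xD xS] ->; rewrite sub1set xS imset_f.
Qed.

Lemma card_singleton_block D B : B \in singleton_blocks D -> #|B| = 1%N.
Proof. by case/imsetP => x _ ->; rewrite cards1. Qed.

(** The union bound over all pairs [(X, B)]: there are at most [(2 * n) ^ k / k!]
    pairs with [#|X| + #|B| = k], so the weights [n ^ (- k)] that the term
    [(#|X| + #|B|) * ln n] provides sum up to at most [exp 2]. *)
Lemma prob_blocks_uniform r (F : {set T} -> {set T} -> {set {set T}}) (a : R) :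
  (forall X B, trivIset (F X B)) ->
  (forall X B C, C \in F X B -> #|C| = r) ->
  prob_random_subset p (fun S => [exists X : {set T}, [exists B : {set T},
     (400 * ((#|X| + #|B|)%:R * ln #|T|%:R + a) <= p ^+ r * #|F X B|%:R) &&
     ((blocks_in (F X B) S)%:R < 9/10 * (p ^+ r * #|F X B|%:R))]]) <=
  expR (2 - a).
Proof.
move=> trF cF.
set L := ln _.
have term (X B : {set T}) : prob_random_subset p (fun S =>
     (400 * ((#|X| + #|B|)%:R * L + a) <= p ^+ r * #|F X B|%:R) &&
     ((blocks_in (F X B) S)%:R < 9/10 * (p ^+ r * #|F X B|%:R))) <=
     expR (- a) * (expR (- L) ^+ #|X| * expR (- L) ^+ #|B|).
  rewrite -!expRM_natr -!expRD.
  case: (boolP (400 * _ <= _)) => [le|_]; last first.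
    by rewrite prob_expect expect_cst // expR_ge0.
  apply: le_trans (prob_blocks_lower (trF X B) (cF X B)) _.
  by rewrite ler_expR; move: le; rewrite natrD; lra.
have sum1 : \sum_(X : {set T}) expR (- L) ^+ #|X| <= expR 1.
  have -> : \sum_(X : {set T}) expR (- L) ^+ #|X| = (1 + expR (- L)) ^+ #|T|.
    rewrite -prodr_const addrC bigA_distr; apply: eq_bigr => X _.
    by rewrite -big_mkcond prodr_const.
  apply: le_trans (expr1D_le_expR _ _) _; first by rewrite addr_ge0 ?expR_ge0.
  rewrite ler_expR /L; have [->|n0] := posnP #|T|; first by rewrite mulr0.
  by rewrite expRN lnK ?posrE ?ltr0n // mulVf // pnatr_eq0 -lt0n.
apply: le_trans (prob_exists p01 _) _.
apply: (@le_trans _ _ (\sum_(X : {set T}) \sum_(B : {set T})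
    expR (- a) * (expR (- L) ^+ #|X| * expR (- L) ^+ #|B|))).
  apply: ler_sum => X _; apply: le_trans (prob_exists p01 _) _.
  by apply: ler_sum => B _; apply: term.
under eq_bigr => X _ do rewrite -mulr_sumr -mulr_sumr.
rewrite -mulr_sumr -mulr_suml [2 - a]addrC expRD ler_wpM2l ?expR_ge0 //.
rewrite (_ : 2 = 1 + 1 :> R) ?expRD; last by ring.
by apply: ler_pM => //; apply: sumr_ge0 => X _; rewrite exprn_ge0 ?expR_ge0.
Qed.

End Chernoff.

(** * Fingerprints, double counting and matchings *)

Section Graph.
Variables (R : realType) (T : finType) (e : rel T).
Implicit Types (A B U X Y S : {set T}) (M : {set {set T}}).

Definition nbhd (x : T) : {set T} := [set y | e x y].

Definition nbhds (X : {set T}) : {set T} := \bigcup_(x in X) nbhd x.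

(** Take [X] maximal among the subsets of [U] satisfying the size condition: a
    vertex [u] with more than [h] new neighbors in [Y] could be added to it.  The
    size condition makes [X] small compared with what it sees, which is what the
    union bound over [X] needs. *)
Lemma fingerprint (h : R) U Y : 0 <= h ->
  exists X, [/\ X \subset U, h * #|X|%:R <= #|nbhds X :&: Y|%:R &
    forall u, u \in U -> #|(nbhd u :&: Y) :\: nbhds X|%:R <= h].
Proof.
move=> h0.
pose P X := (X \subset U) && (h * #|X|%:R <= #|nbhds X :&: Y|%:R).
have P0 : P set0 by rewrite /P sub0set cards0 mulr0 ler0n.
have [X /maxsetP[/andP[XU hX] maxX] _] := maxset_exists P0.
exists X; split=> // u uU; rewrite leNgt; apply/negP => lth.
have [uX|uX] := boolP (u \in X).
  suff z : (nbhd u :&: Y) :\: nbhds X = set0.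
    by move: lth; rewrite z cards0 ltNge h0.
  apply/eqP; rewrite setD_eq0; apply: subset_trans (subsetIl _ _) _.
  exact: bigcup_sup.
have PX : P (u |: X).
  rewrite /P subUset sub1set uU XU /= cardsU1 uX natrD mulrDr mulr1.
  rewrite /nbhds bigcup_setU big_set1 -/(nbhds X).
  rewrite (_ : (_ :|: _) :&: Y =
     ((nbhd u :&: Y) :\: nbhds X) :|: (nbhds X :&: Y)); last first.
    by apply/setP => y; rewrite !inE; case: (y \in Y); case: (y \in nbhds X);
      rewrite ?andbF ?andbT ?orbT ?orbF.
  rewrite cardsU (_ : _ :&: (nbhds X :&: Y) = set0) ?cards0 ?subn0; last first.
    by apply/setP => y; rewrite !inE; case: (y \in nbhds X); rewrite ?andbF.
  by rewrite natrD lerD // ltW.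
have /setP/(_ u) := maxX _ PX (subsetUr _ _).
by rewrite !inE eqxx (negbTE uX).
Qed.

Lemma double_count (h k : R) A Y : symmetric e ->
  (forall a, a \in A -> h <= #|nbhd a :&: Y|%:R) ->
  (forall y, y \in Y -> #|nbhd y :&: A|%:R <= k) ->
  h * #|A|%:R <= k * #|Y|%:R.
Proof.
move=> symE hA kY.
have cnt B C : (\sum_(b in B) #|nbhd b :&: C| = \sum_(b in B) \sum_(c in C) e b c)%N.
  apply: eq_bigr => b _; rewrite -sum1_card (eq_bigl (fun c => (c \in C) && e b c)).
    by rewrite big_mkcondr; apply: eq_bigr => c _; case: (e b c).
  by move=> c; rewrite !inE andbC.
have -> : h * #|A|%:R = \sum_(a in A) h by rewrite sumr_const mulr_natr.
have -> : k * #|Y|%:R = \sum_(y in Y) k by rewrite sumr_const mulr_natr.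
apply: (@le_trans _ _ (\sum_(a in A) #|nbhd a :&: Y|)%N%:R).
  by rewrite natr_sum; apply: ler_sum.
rewrite cnt exchange_big /= (eq_bigr (fun y => (\sum_(a in A) e y a)%N)); last first.
  by move=> y _; apply: eq_bigr => a _; rewrite symE.
by rewrite -cnt natr_sum; apply: ler_sum.
Qed.

Definition crossing_matching (A : {set T}) (M : {set {set T}}) : bool :=
  trivIset M && [forall B in M, [exists a in A, [exists v in ~: A,
     e a v && (B == [set a; v])]]].

Lemma crossing_edgeP A M B : crossing_matching A M -> B \in M ->
  exists a v, [/\ a \in A, v \notin A, e a v & B = [set a; v]].
Proof.
move=> /andP[_ /forall_inP cM] /cM /exists_inP[a aA /exists_inP[v]].
by rewrite inE => vA /andP[eav /eqP ->]; exists a, v.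
Qed.

Lemma card_crossing_edge A M B : crossing_matching A M -> B \in M -> #|B| = 2%N.
Proof.
move=> cM /(crossing_edgeP cM)[a [v [aA vA _ ->]]]; rewrite cards2.
by case: eqP => // av; rewrite -av aA in vA.
Qed.

Lemma crossing_matchingC A M : symmetric e ->
  crossing_matching (~: A) M -> crossing_matching A M.
Proof.
move=> symE cM; have /andP[trM _] := cM; rewrite /crossing_matching trM; apply/forall_inP => B BM.
have [a [v [aA vA eav ->]]] := crossing_edgeP cM BM.
apply/exists_inP; exists v; first by move: vA; rewrite inE negbK.
apply/exists_inP; exists a => //; by rewrite symE eav finset.setUC eqxx.
Qed.

(** For a maximal matching [M], the vertices of [A] that it leaves uncovered have
    all their neighbors outside [A] covered by [M], hence at most [2 * #|M|]
    external neighbors; expansion of that part of [A] then bounds [#|M|] below. *)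
Lemma crossing_matching_small (lambda : R) A : symmetric e ->
  0 <= lambda <= 1 -> is_expander lambda e -> #|A|%:R <= #|T|%:R / 2 :> R ->
  exists2 M, crossing_matching A M & lambda * #|A|%:R <= 4 * #|M|%:R.
Proof.
move=> symE /andP[l0 l1] /forall_inP expE cardA.
have P0 : crossing_matching A set0.
  apply/andP; split; last by apply/forall_inP => B; rewrite inE.
  by apply/trivIsetP => B; rewrite inE.
have [M /maxsetP[cM maxM] _] := maxset_exists P0.
exists M => //.
pose C := cover M.
have cC : (#|C| <= 2 * #|M|)%N.
  apply: leq_trans (leq_card_cover M).1 _.
  have -> : (\sum_(B in M) #|B| = \sum_(B in M) 2)%N.
    by apply: eq_bigr => B /(card_crossing_edge cM).
  by rewrite sum_nat_const mulnC.
have sub : ext_neighborhood e (A :\: C) \subset C.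
  apply/subsetP => y; rewrite !inE => /andP[yAC /exists_inP[x]].
  rewrite !inE => /andP[xC xA] exy.
  apply/negPn/negP => yC; rewrite yC /= in yAC.
  have cM' : crossing_matching A ([set x; y] |: M).
    have [/trivIsetP trM /forall_inP aM] := andP cM.
    apply/andP; split.
      have dis B : B \in M -> [disjoint [set x; y] & B].
        move=> BM; rewrite disjoints_subset; apply/subsetP => z; rewrite !inE.
        have BC : B \subset C by apply: bigcup_sup.
        by case/orP => /eqP ->; [apply: contraNN xC | apply: contraNN yC];
          apply/subsetP.
      apply/trivIsetP => B B'; rewrite !inE => /orP[/eqP->|BM] /orP[/eqP->|BM'].
      + by rewrite eqxx.
      + by move=> _; apply: dis.
      + by move=> _; rewrite disjoint_sym; apply: dis.
      + exact: trM.
    apply/forall_inP => B; rewrite !inE => /orP[/eqP ->|/aM //].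
    apply/exists_inP; exists x => //; apply/exists_inP; exists y; rewrite ?inE //.
    by rewrite exy eqxx.
  have Mxy : [set x; y] \in M.
    by rewrite -(maxM _ cM' (subsetUr _ _)) setU11.
  by case/negP: xC; apply/bigcupP; exists [set x; y] => //; rewrite !inE eqxx.
have cA : (#|A| <= #|A :\: C| + #|C|)%N.
  by rewrite -(cardsID C A) addnC leq_add2l subset_leq_card ?subsetIr.
have /expE le1 : #|A :\: C|%:R <= #|T|%:R / 2 :> R.
  by apply: le_trans cardA; rewrite ler_nat subset_leq_card ?subsetDl.
have le2 : (#|ext_neighborhood e (A :\: C)| <= #|C|)%N by apply: subset_leq_card.
move: cA cC le2; rewrite -!(ler_nat R) natrD natrM => cA cC le2.
have := ler0n R #|M|; nra.
Qed.

Lemma crossing_matching_exists (lambda : R) A : symmetric e ->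
  0 <= lambda <= 1 -> is_expander lambda e ->
  exists2 M, crossing_matching A M &
    lambda * Num.min #|A|%:R #|~: A|%:R <= 4 * #|M|%:R.
Proof.
move=> symE l01 expE.
have cT : #|A|%:R + #|~: A|%:R = #|T|%:R :> R by rewrite -natrD cardsC.
have [leA|ltA] := leP (#|A|%:R : R) (#|~: A|%:R).
  by apply: crossing_matching_small => //; lra.
have [|M cM leM] := @crossing_matching_small lambda (~: A) symE l01 expE; first lra.
by exists M => //; apply: crossing_matchingC.
Qed.

Lemma leq_card_hitting M (C : {set T}) : trivIset M ->
  (forall B, B \in M -> exists2 x, x \in B & x \in C) -> (#|M| <= #|C|)%N.
Proof.
move=> trM hit; apply: leq_trans (leq_imset_card (finset.pblock M) (mem C)).
apply/subset_leq_card/subsetP => B BM; have [x xB xC] := hit _ BM.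
by apply/imsetP; exists x; rewrite // (def_pblock trM BM xB).
Qed.

End Graph.

(** * Deterministic part: concentration forces expansion *)

Section Deterministic.
Variables (R : realType) (T : finType) (e : rel T) (d : nat) (lambda p L Lambda a : R).
Implicit Types (A B U X Y S : {set T}) (M : {set {set T}}).

(** The approximation of a set [U] that can be read off from the neighborhood [Y]
    of a fingerprint of [U]. *)
Definition core (Y : {set T}) : {set T} :=
  [set v | 9/10 * d%:R <= #|nbhd e v :&: Y|%:R :> R].

(** The lower tail bound, required only when the expected count exceeds the price
    of the pair [(X, B)] in the union bound plus a margin [a], which controls
    the total failure probability. *)
Definition concentrated r (F : {set T} -> {set T} -> {set {set T}})
    (S : {set T}) : Prop :=
  forall X B, 400 * ((#|X| + #|B|)%:R * L + a) <= p ^+ r * #|F X B|%:R ->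
    9/10 * (p ^+ r * #|F X B|%:R) <= (blocks_in (F X B) S)%:R.

Variable m : {set T} -> {set {set T}}.
Hypothesis symE : symmetric e.
Hypothesis mC : forall A, crossing_matching e A (m A).
Hypothesis m_large : forall A,
  lambda * Num.min #|A|%:R #|~: A|%:R <= 4 * #|m A|%:R.
Hypothesis p01 : 0 < p <= 1.
Hypothesis lambda01 : 0 < lambda <= 1.
Hypothesis d_gt0 : (0 < d)%N.
Hypothesis deg_ge : forall v, d%:R <= #|nbhd e v|%:R :> R.
Hypothesis deg_le : forall v, #|nbhd e v|%:R <= 11/10 * d%:R :> R.
Hypothesis LambdaE : Lambda = p ^+ 2 * lambda * d%:R.
Hypothesis a_Lambda : 10 ^+ 7 * a = Lambda.
Hypothesis L_le : 10 ^+ 7 * L <= Lambda.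

Variable S : {set T}.
Hypothesis cardS : #|S|%:R <= 11/10 * (p * #|T|%:R) :> R.
Hypothesis degS : forall v, #|nbhd e v :&: S|%:R <= 121/100 * (p * d%:R) :> R.
Hypothesis conc_nbhds :
  concentrated 1 (fun X _ => singleton_blocks (nbhds e X)) S.
Hypothesis conc_outside :
  concentrated 1 (fun X _ => singleton_blocks (nbhds e X :\: core (nbhds e X))) S.
Hypothesis conc_matching :
  concentrated 2 (fun X _ => m (core (nbhds e X))) S.
Hypothesis conc_common :
  concentrated 1 (fun X B => singleton_blocks (nbhds e B :&: nbhds e X)) S.

Lemma concentrated_singleton_blocks G X B :
  concentrated 1 (fun X B => singleton_blocks (G X B)) S ->
  400 * ((#|X| + #|B|)%:R * L + a) <= p * #|G X B|%:R ->
  9/10 * (p * #|G X B|%:R) <= #|G X B :&: S|%:R.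
Proof.
by move=> /(_ X B); rewrite expr1 card_singleton_blocks blocks_in_singleton_blocks.
Qed.

Lemma in_nbhds X y : (y \in nbhds e X) = [exists x in X, e x y].
Proof.
apply/bigcupP/exists_inP => [[x xX]|[x xX xy]]; first by rewrite inE; exists x.
by exists x; rewrite ?inE.
Qed.

(** The argument by fingerprints: with [q = p * lambda * #|U|], the rare events
    have expected counts of order at least [q], whereas the price of [X] together
    with the margin [a] is at most [q / 500] ([cost_X]); the price of the second
    fingerprint [B] is covered by the size of its own neighborhood. *)
Lemma expanding_sets_survive U : U \subset S -> #|U|%:R <= #|S|%:R / 2 :> R ->
  p * lambda / 100 * #|U|%:R <= #|(nbhds e U :&: S) :\: U|%:R.
Proof.
move=> US cardU; set W := _ :\: U.
have /andP[p0 p1] := p01; have /andP[l0 l1] := lambda01.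
have d0 : 0 < d%:R :> R by rewrite ltr0n.
have [->|[u0 u0U]] := set_0Vmem U; first by rewrite cards0 mulr0.
have u_gt0 : 0 < #|U|%:R :> R by rewrite ltr0n; apply/card_gt0P; exists u0.
rewrite leNgt; apply/negP => w_lt.
set u : R := #|U|%:R in w_lt u_gt0 cardU.
set s : R := #|S|%:R in cardU.
have s_le : s <= 11/10 * (p * #|T|%:R) := cardS.
set w : R := #|W|%:R in w_lt.
pose q := p * lambda * u.
have pl0 : 0 < p * lambda by rewrite mulr_gt0.
have q_gt0 : 0 < q by rewrite mulr_gt0.
have w_q : w < q / 100 by rewrite /q; lra.
have pl1 : p * lambda <= 1 by rewrite mulr_ile1 // ltW.
have q_u : q <= u by rewrite /q ler_piMl // ltW.
have UW y : y \in nbhds e U -> y \in S -> y \in U :|: W.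
  by move=> yN yS; rewrite /W !inE yN yS andbT; case: (y \in U).
(* [X] with its neighborhood [Y] stands for [U] in all the events below. *)
have [|X [XU cardX coverX]] := @fingerprint R T e (d%:R / 10) U finset.setT.
  by lra.
rewrite finset.setIT in cardX.
set Y := nbhds e X in cardX coverX.
have YU : Y \subset nbhds e U.
  apply/subsetP => y; rewrite !in_nbhds => /exists_inP[x xX exy].
  by apply/exists_inP; exists x => //; apply: (subsetP XU).
set y : R := #|Y|%:R in cardX.
set x : R := #|X|%:R in cardX.
have U_degY v : v \in U -> 9/10 * d%:R <= #|nbhd e v :&: Y|%:R :> R.
  move=> vU; have := coverX v vU; rewrite finset.setIT.
  have := deg_ge v; rewrite -(cardsID Y (nbhd e v)) natrD; lra.
pose A := core Y.
have UA : U \subset A by apply/subsetP => v /U_degY; rewrite inE.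
have y_d : 9/10 * d%:R <= y.
  by apply: le_trans (U_degY _ u0U) _; rewrite ler_nat subset_leq_card ?subsetIr.
have Lam_pd : Lambda <= p * d%:R.
  rewrite (_ : Lambda = (p * lambda) * (p * d%:R)); last by rewrite LambdaE; ring.
  by rewrite ler_piMl // mulr_ge0 // ltW.
have x_ge0 : 0 <= x by rewrite ler0n.
have pdx : p * d%:R * x <= 10 * (p * y).
  have : p * (d%:R / 10 * x) <= p * y by rewrite ler_wpM2l // ltW.
  by lra.
have pd_y : 9/10 * (p * d%:R) <= p * y.
  have : p * (9/10 * d%:R) <= p * y by rewrite ler_wpM2l // ltW.
  by lra.
have xL : 10 ^+ 7 * (x * L) <= 10 * ((p * lambda) * (p * y)).
  have h1 : x * (10 ^+ 7 * L) <= x * Lambda by rewrite ler_wpM2l.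
  have h2 : (p * lambda) * (p * d%:R * x) <= (p * lambda) * (10 * (p * y)).
    by rewrite ler_wpM2l // ltW.
  by move: h1 h2; rewrite LambdaE; lra.
have Lam_y : 9/10 * Lambda <= (p * lambda) * (p * y).
  have : (p * lambda) * (9/10 * (p * d%:R)) <= (p * lambda) * (p * y).
    by rewrite ler_wpM2l // ltW.
  by rewrite LambdaE; lra.
have a_Lam : 10 ^+ 7 * a = Lambda := a_Lambda.
have py0 : 0 <= p * y by rewrite mulr_ge0 ?ler0n // ltW.
have ply_y : (p * lambda) * (p * y) <= p * y by rewrite ler_piMl // mulr_ge0 // ltW.
(* [#|Y|] is close to [#|U| / p], as the survivors of [Y] are in [U :|: W] and
   conversely [U] sends [9/10 * d * #|U|] edges into [Y]. *)
have y_le : 9/10 * (p * y) <= u + w.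
  have : 9/10 * (p * y) <= #|Y :&: S|%:R.
    apply: (@concentrated_singleton_blocks (fun X _ => nbhds e X) X set0) => //.
    by rewrite cards0 addn0 -/Y -/x -/y; lra.
  move/le_trans; apply; rewrite -natrD ler_nat.
  apply: leq_trans (leq_card_setU U W); apply/subset_leq_card/subsetP => v.
  by rewrite finset.inE => /andP[/(subsetP YU) vU vS]; apply: UW.
have y_ge : 9/10 * u <= 121/100 * (p * y).
  have h := @double_count R T e (9/10 * d%:R) (121/100 * (p * d%:R)) U Y symE U_degY.
  have h' : 9/10 * d%:R * u <= 121/100 * (p * d%:R) * y.
    apply: h => v _; apply: le_trans (degS v).
    by rewrite ler_nat subset_leq_card // finset.setIS.
  by rewrite -(ler_pM2l d0); lra.
have ply_q : (p * lambda) * (p * y) <= 2 * q.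
  have : (p * lambda) * (p * y) <= (p * lambda) * (2 * u).
    by rewrite ler_pM2l //; lra.
  by rewrite /q; lra.
have cost_X : 400 * (x * L + a) <= q / 500 by lra.
(* From [Y] to [A]: an upper bound by counting edges, a lower bound since
   survivors of [Y :\: A] are all in [W]. *)
have A_le : p * #|A|%:R <= 11/9 * (p * y).
  have : 9/10 * d%:R * #|A|%:R <= 11/10 * d%:R * y.
    apply: (@double_count R T e _ _ A Y symE) => [v|v _]; first by rewrite inE.
    by apply: le_trans (deg_le v); rewrite ler_nat subset_leq_card ?subsetIl.
  have -> : 9/10 * d%:R * #|A|%:R = d%:R * (9/10 * #|A|%:R) :> R by ring.
  have -> : 11/10 * d%:R * y = d%:R * (11/10 * y) :> R by ring.
  rewrite ler_pM2l // => h.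
  have : p * (9/10 * #|A|%:R) <= p * (11/10 * y) by rewrite ler_pM2l.
  by lra.
have YA_le : p * #|Y :\: A|%:R <= u / 5.
  rewrite leNgt; apply/negP => big.
  have : 9/10 * (p * #|Y :\: A|%:R) <= #|(Y :\: A) :&: S|%:R.
    apply: (@concentrated_singleton_blocks
      (fun X _ => nbhds e X :\: core (nbhds e X)) X set0) => //.
    by rewrite cards0 addn0 -/Y -/x -/A; lra.
  suff : #|(Y :\: A) :&: S|%:R <= w by lra.
  rewrite ler_nat; apply/subset_leq_card/subsetP => v; rewrite finset.inE.
  move=> /andP[/setDP[vY vA] vS]; rewrite /W 2!finset.inE vS (subsetP YU) // !andbT.
  by apply: contraNN vA => /(subsetP UA).
have A_ge : 13/25 * u <= p * #|A|%:R.
  have : p * y <= p * (#|Y :\: A|%:R + #|A|%:R).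
    rewrite ler_pM2l // -natrD ler_nat -(cardsID A Y) addnC leq_add2l.
    by rewrite subset_leq_card ?subsetIr.
  by lra.
have Ac_ge : 2/5 * u <= p * #|~: A|%:R.
  have cT : p * #|A|%:R + p * #|~: A|%:R = p * #|T|%:R.
    by rewrite -mulrDr -natrD cardsC.
  by lra.
(* [A] occupies neither nearly nothing nor nearly everything, so the matching
   across it is large, and a [p ^+ 2] fraction of it survives. *)
have mA_ge : q / 10 <= p ^+ 2 * #|m A|%:R.
  have h := m_large A.
  have h1 : 2/5 * u <= p * Num.min #|A|%:R #|~: A|%:R.
    by rewrite minEle; case: ifP => _; lra.
  rewrite -(ler_pM2l pl0) in h1.
  have : p ^+ 2 * (lambda * Num.min #|A|%:R #|~: A|%:R) <= p ^+ 2 * (4 * #|m A|%:R).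
    by rewrite ler_pM2l // exprn_gt0.
  by move: h1; rewrite /q; lra.
have surviving : 9/100 * q <= (blocks_in (m A) S)%:R.
  have : 9/10 * (p ^+ 2 * #|m A|%:R) <= (blocks_in (m A) S)%:R.
    by apply: (conc_matching (B := set0)); rewrite cards0 addn0 -/Y -/x -/A; lra.
  by lra.
(* A surviving matching edge that avoids [W] cannot start in [U], since its other
   end would then be in [W]; so it starts in [Z]. *)
pose Z := (A :&: S) :\: (U :|: W).
have Z_large : 2/25 * q <= #|Z|%:R.
  suff : (blocks_in (m A) S)%:R <= #|Z|%:R + w by lra.
  rewrite -natrD ler_nat; apply: leq_trans (leq_card_setU Z W).
  have trm : trivIset (m A) by have /andP[] := mC A.
  apply: leq_card_hitting.
    by apply: trivIsetS trm; apply/subsetP => B; rewrite inE => /andP[].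
  move=> B; rewrite inE => /andP[Bm BS].
  have [b [v [bA vA ebv EB]]] := crossing_edgeP (mC A) Bm.
  have bS : b \in S by apply: (subsetP BS); rewrite EB !inE eqxx.
  have vS : v \in S by apply: (subsetP BS); rewrite EB !inE eqxx orbT.
  have vU : v \notin U by apply: contraNN vA => /(subsetP UA).
  have [bU|bU] := boolP (b \in U).
    exists v; first by rewrite EB !inE eqxx orbT.
    rewrite !inE vU vS in_nbhds andbT /= orbC.
    by rewrite (_ : [exists _ in U, _]) //; apply/exists_inP; exists b.
  exists b; first by rewrite EB !inE eqxx.
  by rewrite in_setU in_setD in_setU in_setI bA bS (negbTE bU) /=; case: (b \in W).
(* [Z] is too large to be a set of vertices whose surviving neighbors in [Y]
   are confined to [W]; its fingerprint [B] makes this a rare event. *)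
have [|B [BZ cardB coverB]] := @fingerprint R T e (d%:R / 2) Z Y.
  by lra.
set N := nbhds e B :&: Y in cardB.
have NW : N :&: S \subset W.
  apply/subsetP => v; rewrite !finset.inE in_nbhds => /andP[/andP[vB vY] vS].
  have := UW v (subsetP YU _ vY) vS; rewrite finset.inE => /orP[vU|]; last first.
    by rewrite /W !finset.inE.
  have /exists_inP[b /(subsetP BZ) bZ ebv] := vB.
  move: bZ; rewrite in_setD in_setU in_setI negb_or => /andP[/andP[bU bW] /andP[_ bS]].
  case/negP: bW; rewrite /W in_setD in_setI bU bS in_nbhds /= andbT.
  by apply/exists_inP; exists v; rewrite // symE.
have N_small : p * #|N|%:R < q / 50.
  rewrite ltNge; apply/negP => big.
  have pd : p * d%:R * #|B|%:R <= 2 * (p * #|N|%:R).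
    have : p * (d%:R / 2 * #|B|%:R) <= p * #|N|%:R by rewrite ler_pM2l.
    by lra.
  have BL : 10 ^+ 7 * (#|B|%:R * L) <= 2 * (p * #|N|%:R).
    have h1 : #|B|%:R * (10 ^+ 7 * L) <= #|B|%:R * Lambda by rewrite ler_wpM2l.
    have h2 : #|B|%:R * Lambda <= #|B|%:R * (p * d%:R) by rewrite ler_wpM2l.
    by lra.
  have : 9/10 * (p * #|N|%:R) <= #|N :&: S|%:R.
    apply: (@concentrated_singleton_blocks
      (fun X B => nbhds e B :&: nbhds e X) X B) => //.
    by rewrite natrD -/Y -/x -/N mulrDl; lra.
  have : #|N :&: S|%:R <= w by rewrite ler_nat subset_leq_card.
  by lra.
have : 2/5 * d%:R * #|Z|%:R <= 121/100 * (p * d%:R) * #|N|%:R.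
  apply: double_count => // v.
    move=> vZ; have := coverB v vZ.
    have : v \in A by move: vZ; rewrite in_setD in_setI => /andP[_ /andP[]].
    rewrite inE -(cardsID (nbhds e B) (nbhd e v :&: Y)) natrD.
    rewrite (_ : nbhd e v :&: Y :&: nbhds e B = nbhd e v :&: N); first by lra.
    by rewrite /N -finset.setIA [Y :&: _]finset.setIC.
  move=> _; apply: le_trans (degS v); rewrite ler_nat subset_leq_card //.
  by rewrite finset.setIS // /Z; apply: subset_trans (subsetDl _ _) (subsetIr _ _).
have -> : 2/5 * d%:R * #|Z|%:R = d%:R * (2/5 * #|Z|%:R) :> R by ring.
have -> : 121/100 * (p * d%:R) * #|N|%:R = d%:R * (121/100 * (p * #|N|%:R)) :> R by ring.
by rewrite ler_pM2l //; lra.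
Qed.

End Deterministic.

(** * Transfer to the induced subgraph and union bound *)

Lemma induced_expander (R : realType) (T : finType) (e : rel T) (mu : R)
    (S : {set T}) :
  (forall U : {set T}, U \subset S -> #|U|%:R <= #|S|%:R / 2 :> R ->
     mu * #|U|%:R <= #|(nbhds e U :&: S) :\: U|%:R) ->
  is_expander mu (induced_subgraph e S).
Proof.
move=> survive; apply/forall_inP => V cardV.
have cardVV : #|[set val u | u in V]| = #|V| by apply/card_imset/val_inj.
rewrite -cardVV in cardV *.
have cardsig : #|{: {x : T | x \in S}}| = #|S| by rewrite card_sig.
rewrite cardsig in cardV.
apply: le_trans (survive _ _ cardV) _.
  by apply/subsetP => _ /imsetP[u _ ->]; apply: valP.
rewrite ler_nat -(card_imset (ext_neighborhood _ V) val_inj).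
apply/subset_leq_card/subsetP => y /setDP[/setIP[]].
rewrite in_nbhds => /exists_inP[_ /imsetP[u uV ->] euy] yS yU.
apply/imsetP; exists (exist _ y yS) => //; rewrite inE; apply/andP; split.
  by apply: contraNN yU => yV; apply/imsetP; exists (exist _ y yS).
by apply/exists_inP; exists u.
Qed.

Section Survival.
Variables (R : realType) (T : finType) (e : rel T) (d : nat) (lambda p L Lambda a : R).
Hypothesis symE : symmetric e.
Hypothesis expE : is_expander lambda e.
Hypothesis p01 : 0 < p <= 1.
Hypothesis lambda01 : 0 < lambda <= 1.
Hypothesis T_gt0 : (0 < #|T|)%N.
Hypothesis d_gt0 : (0 < d)%N.
Hypothesis deg_ge : forall v, d%:R <= #|nbhd e v|%:R :> R.
Hypothesis deg_le : forall v, #|nbhd e v|%:R <= 11/10 * d%:R :> R.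
Hypothesis LambdaE : Lambda = p ^+ 2 * lambda * d%:R.
Hypothesis a_Lambda : 10 ^+ 7 * a = Lambda.
Hypothesis LE : L = ln #|T|%:R.
Hypothesis L_le : 10 ^+ 7 * L <= Lambda.
Hypothesis a_ge : 16 <= a.

Definition deviates r (F : {set T} -> {set T} -> {set {set T}}) (S : {set T}) : bool :=
  [exists X : {set T}, [exists B : {set T},
     (400 * ((#|X| + #|B|)%:R * L + a) <= p ^+ r * #|F X B|%:R) &&
     ((blocks_in (F X B) S)%:R < 9/10 * (p ^+ r * #|F X B|%:R))]].

Lemma deviatesPn r F S : ~~ deviates r F S -> concentrated p L a r F S.
Proof.
move=> /existsPn nd X B le; have /existsPn/(_ B) := nd X.
by rewrite le /= -leNgt.
Qed.

(** Six kinds of bad events, each of probability at most [expR (2 - a)]; the factor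
    [6] and the constant are absorbed by half of [a]. *)
Lemma prob_induced_expander :
  1 - expR (- (a / 2)) <= prob_random_subset p
    (fun S => is_expander (1 / 100 * (p * lambda)) (induced_subgraph e S)).
Proof.
have /andP[p0 p1] := p01; have /andP[l0 l1] := lambda01.
have p01' : 0 <= p <= 1 by rewrite ltW.
have l01' : 0 <= lambda <= 1 by rewrite ltW.
have d0 : 0 < d%:R :> R by rewrite ltr0n.
have /choice[m m_prop] : forall A : {set T}, exists M, crossing_matching e A M /\
    lambda * Num.min #|A|%:R #|~: A|%:R <= 4 * #|M|%:R.
  move=> A; have [M cM leM] := crossing_matching_exists A symE l01' expE.
  by exists M.
pose bad_deg (S : {set T}) := [exists v, 11/10 * (p * #|nbhd e v|%:R) < #|nbhd e v :&: S|%:R].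
pose bad_size (S : {set T}) := 11/10 * (p * #|T|%:R) < #|S|%:R.
pose F1 (X B : {set T}) := singleton_blocks (nbhds e X).
pose F2 (X B : {set T}) := singleton_blocks (nbhds e X :\: core R e d (nbhds e X)).
pose F3 (X B : {set T}) := m (core R e d (nbhds e X)).
pose F4 (X B : {set T}) := singleton_blocks (nbhds e B :&: nbhds e X).
pose bad S := bad_deg S || (bad_size S || (deviates 1 F1 S || (deviates 1 F2 S ||
  (deviates 2 F3 S || deviates 1 F4 S)))).
have Lam_pd : Lambda <= p * d%:R.
  rewrite (_ : Lambda = (p * lambda) * (p * d%:R)); last by rewrite LambdaE; ring.
  by rewrite ler_piMl ?mulr_ge0 ?mulr_ile1 // ltW.
have a_Lam : 10 ^+ 7 * a = Lambda := a_Lambda.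
have L_Lam : 10 ^+ 7 * L <= Lambda := L_le.
have a_ge' : 16 <= a := a_ge.
rewrite prob_compl lerD2l lerN2.
apply: (@le_trans _ _ (prob_random_subset p bad)).
  apply: prob_mono => // S; apply: contraNT; rewrite !negb_or.
  move=> /andP[ndeg /andP[nsize /andP[n1 /andP[n2 /andP[n3 n4]]]]].
  apply: induced_expander => U US cardU.
  rewrite (_ : 1 / 100 * (p * lambda) = p * lambda / 100); last by field.
  apply: (@expanding_sets_survive R T e d lambda p L Lambda a m) => //.
  - by move=> A; have [] := m_prop A.
  - by move=> A; have [] := m_prop A.
  - by rewrite leNgt.
  - move=> v; move/existsPn: ndeg => /(_ v); rewrite -leNgt => /le_trans; apply.
    have : p * #|nbhd e v|%:R <= p * (11/10 * d%:R) by rewrite ler_pM2l.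
    by lra.
  - exact: deviatesPn n1.
  - exact: deviatesPn n2.
  - exact: deviatesPn n3.
  - exact: deviatesPn n4.
have P0 : prob_random_subset p bad_deg <= expR (2 - a).
  apply: le_trans (prob_exists p01' _) _.
  apply: (@le_trans _ _ (\sum_(v : T) expR (- (Lambda / 800)))).
    apply: ler_sum => v _.
    have := @prob_blocks_upper R T p p01' 1 (singleton_blocks (nbhd e v))
      (trivIset_singleton_blocks _) (@card_singleton_block _ _).
    rewrite expr1 card_singleton_blocks => h.
    apply: le_trans (le_trans h _).
      by apply: prob_mono => // S; rewrite blocks_in_singleton_blocks.
    rewrite ler_expR.
    have : p * d%:R <= p * #|nbhd e v|%:R by rewrite ler_pM2l.
    by lra.
  have -> : \sum_(v : T) expR (- (Lambda / 800)) = expR L * expR (- (Lambda / 800)).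
    by rewrite sumr_const LE lnK ?posrE ?ltr0n // mulr_natl.
  rewrite -expRD.
  by rewrite ler_expR; lra.
have P1 : prob_random_subset p bad_size <= expR (2 - a).
  have := @prob_blocks_upper R T p p01' 1 (singleton_blocks [set: T])
    (trivIset_singleton_blocks _) (@card_singleton_block _ _).
  rewrite expr1 card_singleton_blocks cardsT => h.
  apply: le_trans (le_trans h _).
    by apply: prob_mono => // S; rewrite blocks_in_singleton_blocks setTI.
  have /card_gt0P[v _] := T_gt0.
  have : p * d%:R <= p * #|T|%:R.
    by rewrite ler_pM2l // (le_trans (deg_ge v)) // ler_nat max_card.
  by rewrite ler_expR; lra.
have Pd r F : (forall X B, trivIset (F X B)) ->
    (forall X B C, C \in F X B -> #|C| = r) ->
    prob_random_subset p (deviates r F) <= expR (2 - a).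
  by move=> trF cF; rewrite /deviates LE; apply: prob_blocks_uniform.
have P2 := Pd 1%N F1 (fun _ _ => trivIset_singleton_blocks _) (fun _ _ => @card_singleton_block _ _).
have P3 := Pd 1%N F2 (fun _ _ => trivIset_singleton_blocks _) (fun _ _ => @card_singleton_block _ _).
have P5 := Pd 1%N F4 (fun _ _ => trivIset_singleton_blocks _) (fun _ _ => @card_singleton_block _ _).
have P4 : prob_random_subset p (deviates 2 F3) <= expR (2 - a).
  apply: Pd => [X B|X B C]; have [cM _] := m_prop (core R e d (nbhds e X)).
    by have /andP[] := cM.
  exact: card_crossing_edge cM.
have : prob_random_subset p bad <= 6 * expR (2 - a).
  have := le_trans (prob_union p01' _ _) (lerD P0
    (le_trans (prob_union p01' _ _) (lerD P1
    (le_trans (prob_union p01' _ _) (lerD P2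
    (le_trans (prob_union p01' _ _) (lerD P3
    (le_trans (prob_union p01' _ _) (lerD P4 P5))))))))).
  by move/le_trans; apply; lra.
move/le_trans; apply.
apply: (@le_trans _ _ (expR 6 * expR (2 - a))).
  by rewrite ler_wpM2r ?expR_ge0 // (le_trans _ (expR_ge1Dx _)) //; lra.
by rewrite -expRD ler_expR; lra.
Qed.

End Survival.


(** * The theorem *)

Local Open Scope classical_set_scope.
Local Open Scope ring_scope.

Theorem theorem1p5 (R : realType) :
  exists c1 c2 : R, 0 < c1 /\ 0 < c2 /\
  forall (omega eps : nat -> R),
    (omega n @[n --> \oo] --> +oo) ->
    (eps n @[n --> \oo] --> (0 : R)) ->
  exists N : nat, forall n : nat, (N <= n)%N ->
  forall (T : finType) (e : rel T) (d : nat) (lambda p : R),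
    #|T| = n ->
    symmetric e -> irreflexive e ->
    lambda <= 1 ->
    is_expander lambda e ->
    min_degree e = d ->
    (max_degree e)%:R <= (1 + eps n) * d%:R ->
    0 <= p <= 1 ->
    omega n * ln n%:R <= p ^+ 2 * lambda * d%:R ->
    1 - 2 `^ (- (c2 * (p ^+ 2 * lambda * d%:R))) <=
      prob_random_subset p
        (fun S : {set T} => is_expander (c1 * (p * lambda)) (induced_subgraph e S)).
Proof.
exists (1 / 100), (1 / (2 * 10 ^+ 7)); split; first by lra.
split; first by rewrite divr_gt0 // mulr_gt0 // exprn_gt0.
move=> omega eps /cvgryPge/(_ (4 * 10 ^+ 8)) omega_large /cvgr0Pnorm_le eps_small.
have [N1 _ hN1] := omega_large.
have [|N2 _ hN2] := eps_small (1/10) _; first by lra.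
exists (maxn 2 (maxn N1 N2)) => n; rewrite !geq_max => /and3P[n2 nN1 nN2].
move=> T e d lambda p cardT symE _ lambda1 expE mind maxd p01 Lambda_large.
have {hN1 nN1} om : 4 * 10 ^+ 8 <= omega n := hN1 n nN1.
have {hN2 nN2} ep : `|eps n| <= 1 / 10 := hN2 n nN2.
have L_ge : 1 / 2 <= ln n%:R :> R.
  have h2 : ln 2^-1 <= - 2^-1 :> R.
    by have := @le_ln1Dx R (- 2^-1); rewrite (_ : 1 + - 2^-1 = 2^-1 :> R); [apply; lra|field].
  have : ln 2 <= ln n%:R :> R by rewrite ler_ln ?posrE ?ltr0n ?ler_nat // (leq_trans _ n2).
  by move: h2; rewrite lnV ?posrE //; lra.
have L0 : 0 <= ln n%:R :> R by lra.
have om_L : 4 * 10 ^+ 8 * ln n%:R <= p ^+ 2 * lambda * d%:R.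
  by apply: le_trans Lambda_large; rewrite ler_wpM2r.
(* From here on [Lambda / 10 ^+ 7] is the margin [a] of the union bound; the
   threshold [4 * 10 ^+ 8] for [omega] and [1 / 2 <= ln n] make it at least [16]. *)
set Lambda := p ^+ 2 * lambda * d%:R in Lambda_large om_L *.
have Lambda_gt0 : 0 < Lambda by lra.
have /andP[p_ge0 p_le1] := p01.
have p_gt0 : 0 < p.
  rewrite lt_def p_ge0 andbT; apply: contraTneq Lambda_gt0 => p0.
  by rewrite /Lambda p0 expr0n !mul0r ltxx.
have d_gt0 : (0 < d)%N.
  rewrite lt0n; apply: contraTneq Lambda_gt0 => d0.
  by rewrite /Lambda d0 mulr0 ltxx.
have lambda_gt0 : 0 < lambda.
  move: Lambda_gt0; rewrite /Lambda pmulr_lgt0 ?ltr0n // pmulr_rgt0 //.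
  by rewrite exprn_gt0.
have deg_ge v : d%:R <= #|nbhd e v|%:R :> R.
  rewrite ler_nat -mind /min_degree.
  elim: (index_enum T) (mem_index_enum v) => // w s IH.
  rewrite in_cons big_cons => /orP[/eqP <-|/IH]; first exact: geq_minl.
  exact/leq_trans/geq_minr.
have deg_le v : #|nbhd e v|%:R <= 11/10 * d%:R :> R.
  have h : #|nbhd e v|%:R <= (max_degree e)%:R :> R.
    by rewrite ler_nat /max_degree (bigD1 v) //= leq_maxl.
  apply: le_trans h (le_trans maxd _); rewrite ler_wpM2r //.
  by move: ep; rewrite ler_norml => /andP[_]; lra.
have a_ge : 16 <= Lambda / 10 ^+ 7 by lra.
have surv : 1 - expR (- ((Lambda / 10 ^+ 7) / 2)) <= prob_random_subset p
    (fun S => is_expander (1 / 100 * (p * lambda)) (induced_subgraph e S)).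
  apply: (@prob_induced_expander R T e d lambda p (ln n%:R) Lambda) => //.
  - by rewrite p_gt0.
  - by rewrite lambda_gt0.
  - by rewrite cardT (leq_trans _ n2).
  - by field.
  - by rewrite cardT.
  - by lra.
apply: le_trans surv.
rewrite lerD2l lerN2 -/Lambda /powR pnatr_eq0 /= ler_expR.
have ln2 : ln 2 <= 1 :> R.
  by have := @le_ln1Dx R 1; rewrite (_ : 1 + 1 = 2 :> R); [apply; lra|ring].
rewrite -subr_ge0 (_ : _ - _ = (Lambda / 10 ^+ 7) / 2 * (1 - ln 2)); last by field.
by rewrite mulr_ge0 ?subr_ge0 // divr_ge0 // (le_trans _ a_ge).
Qed.
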